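(* Let $(M,g)$ be a general relativistic perfect fluid spacetime of dimension $4$ with isotropic pressure $p$, energy-density $\sigma$, cosmological constant $\lambda$, gravitational constant $k$, whose velocity vector field is a gradient, $\xi:=\mathrm{grad}(f)$ for a smooth function $f$ on $M$, with $g(\xi,\xi)=-1$, and let $\eta$ be the $g$-dual $1$-form of $\xi$. If the equation $$\mathcal{L}_{\xi}g+2S+(2a-r) g+2b\,\eta\otimes \eta=0,$$ with $a,b$ real constants, defines an $\eta$-Einstein soliton $(g,\xi,a,b)$ in $M$ (i.e. the equation holds on $M$), then $f$ satisfies the Poisson equation $$\Delta(f)=-3[b+k(\sigma+p)].$$
   Context: A perfect fluid spacetime here is a $4$-dimensional smooth manifold $M$ with a Lorentzian metric $g$ (one negative sign in the signature), a smooth velocity vector field $\xi$ with $g(\xi,\xi)=-1$ and dual $1$-form $\eta(X)=g(X,\xi)$, and smooth functions $p$ (pressure) and $\sigma$ (energy-density), such that Einstein's equations $kT=S+(\lambda-\frac r2)g$ hold with $T=pg+(\sigma+p)\eta\otimes\eta$; equivalently $$S(X,Y)=\left(\lambda+\frac{k(\sigma-p)}{2}\right)g(X,Y)+k(\sigma+p)\eta(X)\eta(Y)$$ for all vector fields $X,Y$. Here $S$ is the Ricci tensor, $r$ the scalar curvature, $\lambda$ a real constant and $k>0$ a real constant (e.g. $k=8\pi G$). $\mathcal{L}_\xi g$ is the Lie derivative of $g$ along $\xi$, and $\Delta(f)=\mathrm{div}(\mathrm{grad}(f))$, where $\mathrm{div}(X)$ is the trace of $Y\mapsto\nabla_YX$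 for the Levi-Civita connection $\nabla$. *)

(* Defs.v *)
From mathcomp Require Import all_boot all_order all_algebra.
From mathcomp Require Import all_classical all_reals all_analysis.

Set Implicit Arguments.
Unset Strict Implicit.
Unset Printing Implicit Defensive.

Import Order.TTheory GRing.Theory Num.Theory.
Import numFieldNormedType.Exports.

Local Open Scope classical_set_scope.
Local Open Scope ring_scope.

(* Smooth manifolds are presented by an atlas (not necessarily maximal) of
   homeomorphisms [coord c] from open sets [dom c] of a second countable
   Hausdorff space onto open sets of R^n, with inverse [param c].  Tensor fields
   are families of components, one for each chart, related by the usual change
   of coordinates on overlaps; components in the chart [c] are functions on the
   whole space whose values outside [dom c] are irrelevant. *)

Record atlas (R : realType) (n : nat) (M : topologicalType) := Atlas {
  chart : Type;
  dom : chart -> set M;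
  coord : chart -> M -> 'rV[R]_n;
  param : chart -> 'rV[R]_n -> M
}.

Section SmoothFunctions.
Context (R : realType) (n : nat) (M : topologicalType) (A : atlas R n M).
Implicit Types (c d : chart A) (h : M -> R) (U : set M).

(* The partial derivative of [h] with respect to the [i]-th coordinate of [c]. *)
Definition pd c (i : 'I_n) h (x : M) : R :=
  'D_(delta_mx 0 i) (h \o param c) (coord c x).

(* C^oo: all iterated partial derivatives exist and are continuous on [U],
   where [U] is an open subset of [dom c]. *)
Definition smooth_in c U h : Prop :=
  forall (s : seq 'I_n) (x : M), U x ->
    let hs := foldr (pd c) h s in
    {for x, continuous hs} /\
    forall i : 'I_n, derivable (hs \o param c) (coord c x) (delta_mx 0 i).

Definition smooth h : Prop := forall c, smooth_in c (dom c) h.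

(* Row [i], column [j]: the derivative of the [j]-th coordinate of [d] with
   respect to the [i]-th coordinate of [c]. *)
Definition jacobian c d (x : M) : 'M[R]_n :=
  \matrix_(i, j) pd c i (fun y => coord d y 0 j) x.

End SmoothFunctions.

Record is_smooth_atlas (R : realType) (n : nat) (M : topologicalType)
    (A : atlas R n M) : Prop := {
  atlas_cover : forall x : M, exists c : chart A, dom c x;
  atlas_dom_open : forall c : chart A, open (dom c);
  atlas_img_open : forall c : chart A, open (coord c @` dom c);
  atlas_coordK : forall (c : chart A) (x : M), dom c x -> param c (coord c x) = x;
  atlas_coord_cts : forall (c : chart A) (x : M), dom c x ->
    {for x, continuous (coord c)};
  atlas_param_cts : forall (c : chart A) (y : 'rV[R]_n), (coord c @` dom c) y ->
    {for y, continuous (param c)};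
  atlas_transition : forall (c d : chart A) (j : 'I_n),
    smooth_in c (dom c `&` dom d) (fun x => coord d x 0 j)
}.

Record manifold (R : realType) (n : nat) := Manifold {
  space :> topologicalType;
  space_hausdorff : hausdorff_space space;
  space_countable : @second_countable space;
  charts : atlas R n space;
  charts_smooth : is_smooth_atlas charts
}.

Section Tensors.
Context (R : realType) (n : nat) (M : manifold R n).
Local Notation A := (charts M).
Implicit Types (c d : chart A) (x : M) (f : M -> R).

(* Components X^i of a vector field, and components T_ij of a field of bilinear
   forms, in each chart. *)
Definition vector_components := chart A -> M -> 'rV[R]_n.
Definition form_components := chart A -> M -> 'M[R]_n.

Record is_vector_field (X : vector_components) : Prop := {
  vector_smooth : forall c (i : 'I_n), smooth_in c (dom c) (fun x => X c x 0 i);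
  vector_change : forall c d x, dom c x -> dom d x ->
    X d x = X c x *m jacobian c d x
}.

(* diag(-1, 1, ..., 1) *)
Definition minkowski : 'M[R]_n :=
  \matrix_(i, j) ((i == j)%:R * (if val i == 0%N then -1 else 1)).

Record is_lorentz_metric (g : form_components) : Prop := {
  metric_smooth : forall c (i j : 'I_n),
    smooth_in c (dom c) (fun x => g c x i j);
  metric_change : forall c d x, dom c x -> dom d x ->
    g c x = jacobian c d x *m g d x *m (jacobian c d x)^T;
  metric_sym : forall c x, dom c x -> (g c x)^T = g c x;
  metric_signature : forall c x, dom c x ->
    exists2 P : 'M[R]_n, P \in unitmx & P *m g c x *m P^T = minkowski
}.

Section Local.
Variables (g : form_components) (c : chart A).
(* Vector fields on [dom c], by their components. *)
Implicit Types X Y Z : M -> 'rV[R]_n.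

Definition frame (i : 'I_n) : M -> 'rV[R]_n := fun=> delta_mx 0 i.

Definition along X f x : R := \sum_i X x 0 i * pd c i f x.

Definition bracket X Y x : 'rV[R]_n :=
  \row_k (along X (fun y => Y y 0 k) x - along Y (fun y => X y 0 k) x).

Definition inner X Y x : R := (X x *m g c x *m (Y x)^T) 0 0.

Definition christoffel (k i j : 'I_n) x : R :=
  2^-1 * \sum_l invmx (g c x) k l *
    (pd c i (fun y => g c y j l) x + pd c j (fun y => g c y i l) x
     - pd c l (fun y => g c y i j) x).

(* The Levi-Civita connection: [nabla X Y] is \nabla_X Y. *)
Definition nabla X Y x : 'rV[R]_n :=
  \row_k (along X (fun y => Y y 0 k) x
          + \sum_i \sum_j christoffel k i j x * X x 0 i * Y x 0 j).

(* R(X, Y)Z *)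
Definition curvature X Y Z x : 'rV[R]_n :=
  nabla X (nabla Y Z) x - nabla Y (nabla X Z) x - nabla (bracket X Y) Z x.

(* (L_X g)(Y, Z) *)
Definition lie_derivative X Y Z x : R :=
  along X (inner Y Z) x - inner (bracket X Y) Z x - inner Y (bracket X Z) x.

End Local.

(* S(Y, Z) is the trace of X |-> R(X, Y)Z. *)
Definition ricci (g : form_components) : form_components := fun c x =>
  \matrix_(i, j) \sum_k curvature g c (frame k) (frame i) (frame j) x 0 k.

(* The trace of the Ricci tensor with respect to g. *)
Definition scalar_curvature (g : form_components) c x : R :=
  \tr (invmx (g c x) *m ricci g c x).

Definition lie_metric (g : form_components) (X : vector_components) :
    form_components := fun c x =>
  \matrix_(i, j) lie_derivative g c (X c) (frame i) (frame j) x.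

(* The components X^i g_ij of the 1-form g(., X). *)
Definition dual_form (g : form_components) (X : vector_components) :
    chart A -> M -> 'rV[R]_n := fun c x => X c x *m g c x.

Definition tensor_square (u : 'rV[R]_n) : 'M[R]_n := u^T *m u.

(* g(grad f, .) = df, i.e. (grad f)^i = d_j f g^ji. *)
Definition gradient (g : form_components) f : vector_components := fun c x =>
  (\row_j pd c j f x) *m invmx (g c x).

(* The trace of Y |-> \nabla_Y X. *)
Definition divergence (g : form_components) (X : vector_components) c x : R :=
  \sum_k nabla g c (frame k) (X c) x 0 k.

Definition laplacian (g : form_components) f c x : R :=
  divergence g (gradient g f) c x.

End Tensors.

(* T = p g + (sigma + p) eta (x) eta *)
Definition stress_energy (R : realType) (n : nat) (M : manifold R n)
    (g : form_components M) (xi : vector_components M) (p sigma : M -> R) :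
    form_components M := fun c x =>
  p x *: g c x + (sigma x + p x) *: tensor_square (dual_form g xi c x).

Record is_perfect_fluid (R : realType) (M : manifold R 4)
    (g : form_components M) (xi : vector_components M) (p sigma : M -> R)
    (lambda k : R) : Prop := {
  fluid_metric : is_lorentz_metric g;
  fluid_velocity : is_vector_field xi;
  fluid_unit : forall (c : chart (charts M)) (x : M), dom c x ->
    inner g c (xi c) (xi c) x = -1;
  fluid_pressure : smooth (charts M) p;
  fluid_density : smooth (charts M) sigma;
  fluid_constant : 0 < k;
  fluid_einstein : forall (c : chart (charts M)) (x : M), dom c x ->
    k *: stress_energy g xi p sigma c x =
    ricci g c x + (lambda - scalar_curvature g c x / 2) *: g c x
}.

Definition is_eta_einstein_soliton (R : realType) (n : nat) (M : manifold R n)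
    (g : form_components M) (xi : vector_components M) (a b : R) : Prop :=
  forall (c : chart (charts M)) (x : M), dom c x ->
    lie_metric g xi c x + 2 *: ricci g c x
      + (2 * a - scalar_curvature g c x) *: g c x
      + (2 * b) *: tensor_square (dual_form g xi c x) = 0.

(* Main.v *)
(* With h = L_xi g, the soliton equation traced with g^-1 and evaluated on
   (xi, xi), together with the same two contractions of Einstein's equation, is a
   linear system in div xi, S(xi, xi), r and a.  It is closed by
   tr(g^-1 h) = 2 div xi and by h(xi, xi) = xi(g(xi, xi)) = 0, which holds
   because g(xi, xi) is constant. *)
Require Import Defs.
From mathcomp Require Import all_boot all_order all_algebra.
From mathcomp Require Import all_classical all_reals all_analysis.
From mathcomp Require Import ring lra.
Import Order.TTheory GRing.Theory Num.Theory.
Import numFieldNormedType.Exports.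
Local Open Scope ring_scope.

(** * Matrix traces and quadratic forms *)

Lemma trace_tensor_square (F : fieldType) (n : nat) (B : 'M[F]_n) (u : 'rV[F]_n) :
  \tr (B *m (u^T *m u)) = (u *m B *m u^T) 0 0.
Proof. by rewrite mulmxA mxtrace_mulC mulmxA /mxtrace big_ord1. Qed.

Lemma mulmx_quadratic (F : fieldType) (n : nat) (u v : 'rV[F]_n) (B : 'M[F]_n) :
  (u *m B *m v^T) 0 0 = \sum_i \sum_j u 0 i * B i j * v 0 j.
Proof.
rewrite mxE exchange_big; apply: eq_bigr => j _.
by rewrite !mxE mulr_suml.
Qed.

(** * Differential calculus in a chart *)

Section ChartCalculus.
Context {R : realType} {n : nat} {M : manifold R n}.
Implicit Types (c : chart (charts M)) (x : M) (h : M -> R) (X : M -> 'rV[R]_n).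

(** The image of [dom c] is open, so near [coord c x] the map [param c] stays in [dom c]. Identities
    known only on [dom c] may therefore be differentiated there. *)
Lemma pd_eq_dom c (i : 'I_n) h1 h2 x :
  (forall y, dom c y -> h1 y = h2 y) -> dom c x -> pd c i h1 x = pd c i h2 x.
Proof.
move=> h12 xc; apply: near_eq_derive.
have opc := @atlas_img_open _ _ _ _ (charts_smooth M) c.
have : nbhs (Defs.coord c x) ((Defs.coord c @` dom c)%classic).
  by apply: open_nbhs_nbhs; split=> //; exists x.
apply: filterS => _ [y yc <-] /=.
by rewrite (atlas_coordK (charts_smooth M) yc) h12.
Qed.

(** Derivability along the coordinate axes only: this is the order-zero content of [smooth_in], and
    it suffices for the sum and product rules of [pd]. *)
Definition pd_derivable c x h : Prop := forall i : 'I_n,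
  derivable (h \o param c) (Defs.coord c x) (delta_mx 0 i).

Lemma smooth_in_pd_derivable c h x :
  smooth_in c (dom c) h -> dom c x -> pd_derivable c x h.
Proof. by move=> hs xc i; have [_] := hs [::] x xc; apply. Qed.

Lemma pd_derivableM c x h1 h2 : pd_derivable c x h1 -> pd_derivable c x h2 ->
  pd_derivable c x (fun y => h1 y * h2 y).
Proof. by move=> d1 d2 i; apply: derivableM (d1 i) (d2 i). Qed.

Lemma comp_sum_param c m (h : 'I_m -> M -> R) :
  (fun y => \sum_i h i y) \o param c = \sum_(i < m) (h i \o param c).
Proof. by apply/funext => y; rewrite fct_sumE. Qed.

Lemma pd_derivable_sum c x m (h : 'I_m -> M -> R) :
  (forall j, pd_derivable c x (h j)) ->
  pd_derivable c x (fun y => \sum_j h j y).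
Proof.
by move=> dh i; rewrite comp_sum_param; apply: derivable_sum => j; apply: dh.
Qed.

Lemma pdM c (i : 'I_n) h1 h2 x :
    dom c x -> pd_derivable c x h1 -> pd_derivable c x h2 ->
  pd c i (fun y => h1 y * h2 y) x = pd c i h1 x * h2 x + h1 x * pd c i h2 x.
Proof.
move=> xc d1 d2; rewrite /pd (deriveM (d1 i) (d2 i)) /=.
by rewrite (atlas_coordK (charts_smooth M) xc) addrC [_ *: _]mulrC.
Qed.

Lemma pd_sum c (i : 'I_n) m (h : 'I_m -> M -> R) x :
    (forall j, pd_derivable c x (h j)) ->
  pd c i (fun y => \sum_j h j y) x = \sum_j pd c i (h j) x.
Proof. by move=> dh; rewrite /pd comp_sum_param derive_sum// => j; apply: dh. Qed.

Lemma alongM c X h1 h2 x :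
    dom c x -> pd_derivable c x h1 -> pd_derivable c x h2 ->
  along c X (fun y => h1 y * h2 y) x =
    along c X h1 x * h2 x + h1 x * along c X h2 x.
Proof.
move=> xc d1 d2; rewrite /along mulr_suml mulr_sumr -big_split.
by apply: eq_bigr => k _ /=; rewrite pdM// mulrDr !mulrA [_ * h1 x]mulrC.
Qed.

Lemma along_sum c X m (h : 'I_m -> M -> R) x :
    (forall j, pd_derivable c x (h j)) ->
  along c X (fun y => \sum_j h j y) x = \sum_j along c X (h j) x.
Proof.
move=> dh; rewrite /along exchange_big; apply: eq_bigr => k _.
by rewrite pd_sum// mulr_sumr.
Qed.

Lemma along_eq_dom c X h1 h2 x :
  (forall y, dom c y -> h1 y = h2 y) -> dom c x -> along c X h1 x = along c X h2 x.
Proof.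
by move=> h12 xc; apply: eq_bigr => k _; rewrite (pd_eq_dom _ _ _ _ _ h12).
Qed.

Lemma pd_cst c (i : 'I_n) (a : R) x : pd c i (fun=> a) x = 0.
Proof. exact: derive_cst. Qed.

Lemma along_cst c X (a : R) x : along c X (fun=> a) x = 0.
Proof. by rewrite /along big1// => k _; rewrite pd_cst mulr0. Qed.

Lemma along_frame c (i : 'I_n) h x : along c (frame i) h x = pd c i h x.
Proof.
rewrite /along (bigD1 i)//= big1 ?addr0 => [|j ji]; rewrite !mxE !eqxx/=.
  by rewrite mul1r.
by rewrite (negPf ji) mul0r.
Qed.

(** * The Lie derivative of the metric in components *)

Definition components_diff c X x : 'M[R]_n :=
  \matrix_(i, k) pd c i (fun y => X y 0 k) x.

Definition form_along c (B : M -> 'M[R]_n) X x : 'M[R]_n :=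
  \matrix_(i, j) along c X (fun y => B y i j) x.

(** A coordinate field has constant components, so one of the two terms of the bracket vanishes. *)
Lemma bracket_frame c X (i : 'I_n) x :
  bracket c X (frame i) x = - row i (components_diff c X x).
Proof.
apply/rowP => k; rewrite !mxE along_frame.
by rewrite (along_cst c X ((delta_mx 0 i : 'rV[R]_n) 0 k)) sub0r !mxE.
Qed.

Lemma inner_frame (g : form_components M) c (i j : 'I_n) x :
  inner g c (frame i) (frame j) x = g c x i j.
Proof.
rewrite /inner /frame mulmx_quadratic (bigD1 i)//= (bigD1 j)//=.
rewrite !mxE !eqxx /= mul1r mulr1 big1 => [|k kj]; last by rewrite !mxE (negPf kj) andbF mulr0.
rewrite big1 ?addr0// => k ki; rewrite big1// => l _.
by rewrite !mxE (negPf ki) andbF !mul0r.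
Qed.

(** Matrix form of the classical X^k ∂_k g_ij + (∂_i X^k) g_kj + g_ik ∂_j X^k; the last two terms
    come from the brackets with the coordinate fields. *)
Lemma lie_metricE (g : form_components M) (X : vector_components M) c x :
  lie_metric g X c x = form_along c (g c) (X c) x
    + components_diff c (X c) x *m g c x + g c x *m (components_diff c (X c) x)^T.
Proof.
apply/matrixP => i j; rewrite mxE /lie_derivative.
rewrite (_ : inner g c (frame i) (frame j) = fun y => g c y i j); last first.
  by apply/funext => y; apply: inner_frame.
rewrite /inner !bracket_frame /frame trmx_delta.
rewrite mulNmx linearN /= mulNmx mulmxN !mxE !opprK.
congr (_ + _ + _).
- rewrite (bigD1 j)//= big1 ?addr0 => [|k kj].
    rewrite !mxE !eqxx mulr1.
    by apply: eq_bigr => k _; rewrite !mxE.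
  by rewrite !mxE (negPf kj) mulr0.
- apply: eq_bigr => k _; rewrite !mxE (bigD1 i)//= big1 ?addr0 => [|l li].
    by rewrite !mxE !eqxx mul1r.
  by rewrite !mxE (negPf li) mul0r.
Qed.

(** A diagonal matrix with entries 1 and -1 is its own inverse. The signature condition then makes
    the metric invertible. *)
Lemma minkowski_unit : Defs.minkowski R n \in unitmx.
Proof.
suff : Defs.minkowski R n *m Defs.minkowski R n = 1%:M by case/mulmx1_unit.
apply/matrixP => i j; rewrite !mxE (bigD1 i)//= big1 ?addr0 => [|k ki]; rewrite !mxE.
  rewrite eqxx mul1r; case: (eqVneq i j) => [_|_]; last by rewrite mul0r mulr0.
  by case: ifP => _; rewrite !mul1r ?mulrNN ?mulr1.
by rewrite eq_sym (negPf ki) !mul0r.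
Qed.

(** * Contractions with a Lorentz metric *)

Context {g : form_components M} (g_metric : is_lorentz_metric g).

Lemma metric_unit c x : dom c x -> g c x \in unitmx.
Proof.
move=> xc; have [P _ gP] := metric_signature g_metric xc.
by move: minkowski_unit; rewrite -gP !unitmx_mul => /andP[/andP[]].
Qed.

Lemma inv_metric_sym c x : dom c x -> (invmx (g c x))^T = invmx (g c x).
Proof. by move=> xc; rewrite trmx_inv (Defs.metric_sym g_metric). Qed.

(** Leibniz rule for Y^i g_ij Z^j, one term per factor. *)
Lemma along_inner (X Y Z : vector_components M) c x :
    is_vector_field Y -> is_vector_field Z -> dom c x ->
  along c (X c) (inner g c (Y c) (Z c)) x =
    (X c x *m components_diff c (Y c) x *m g c x *m (Z c x)^T
     + Y c x *m form_along c (g c) (X c) x *m (Z c x)^T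
     + Y c x *m g c x *m (X c x *m components_diff c (Z c) x)^T) 0 0.
Proof.
move=> vY vZ xc.
have dY i := smooth_in_pd_derivable _ _ _ (vector_smooth vY i) xc.
have dZ i := smooth_in_pd_derivable _ _ _ (vector_smooth vZ i) xc.
have dg i j := smooth_in_pd_derivable _ _ _ (metric_smooth g_metric i j) xc.
rewrite (_ : inner g c (Y c) (Z c) =
    fun y => \sum_i \sum_j Y c y 0 i * g c y i j * Z c y 0 j); last first.
  by apply/funext => y; apply: mulmx_quadratic.
have dYg i j := pd_derivableM _ _ _ _ (dY i) (dg i j).
have dYgZ i j := pd_derivableM _ _ _ _ (dYg i j) (dZ j).
rewrite along_sum => [|i]; last exact: pd_derivable_sum.
rewrite [RHS]mxE [X in X + _]mxE !mulmx_quadratic -!big_split/=; apply: eq_bigr => i _.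
rewrite along_sum// -!big_split/=; apply: eq_bigr => j _.
rewrite !alongM// mulrDl; congr (_ * _ * _ + _ * _ * _ + _ * _).
- by rewrite mxE; apply: eq_bigr => k _; rewrite mxE.
- by rewrite mxE.
- by rewrite mxE; apply: eq_bigr => k _; rewrite mxE.
Qed.

(** Invariantly, both bracket terms vanish since [X, X] = 0. In components, the expansions
    [along_inner] and [lie_metricE] agree up to the order of the summands. *)
Lemma lie_metric_self (X : vector_components M) c x :
    is_vector_field X -> dom c x ->
  (X c x *m lie_metric g X c x *m (X c x)^T) 0 0 =
    along c (X c) (inner g c (X c) (X c)) x.
Proof.
move=> vX xc; rewrite along_inner// lie_metricE.
rewrite !mulmxDr !mulmxDl trmx_mul !mulmxA.
by rewrite (addrC (_ *m form_along _ _ _ _ *m _)).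
Qed.

(* In the contraction \Gamma^k_kj the terms in \partial_k g_jl and
   \partial_l g_kj cancel. *)
Lemma divergenceE (X : vector_components M) c x : dom c x ->
  divergence g X c x =
    \tr (components_diff c (X c) x)
    + 2^-1 * \tr (invmx (g c x) *m form_along c (g c) (X c) x).
Proof.
move=> xc.
have gC i j y : dom c y -> g c y i j = g c y j i.
  by move=> yc; rewrite -[in LHS](Defs.metric_sym g_metric yc) mxE.
have hC i j : invmx (g c x) i j = invmx (g c x) j i.
  by rewrite -[in LHS](inv_metric_sym _ _ xc) mxE.
(* This contracted symbol is ∂_j log sqrt |det g|, written without the determinant. *)
have contraction j : \sum_k christoffel g c k k j x =
    2^-1 * \sum_k \sum_l invmx (g c x) k l * pd c j (fun y => g c y l k) x.
  rewrite /christoffel -mulr_sumr; congr (_ * _).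
  have -> : \sum_k \sum_l invmx (g c x) k l *
      (pd c k (fun y => g c y j l) x + pd c j (fun y => g c y k l) x
       - pd c l (fun y => g c y k j) x) =
      \sum_k \sum_l invmx (g c x) k l * pd c k (fun y => g c y j l) x
      + \sum_k \sum_l invmx (g c x) k l * pd c j (fun y => g c y k l) x
      - \sum_k \sum_l invmx (g c x) k l * pd c l (fun y => g c y k j) x.
    rewrite -!big_split -sumrB /=; apply: eq_bigr => k _.
    by rewrite -!big_split -sumrB /=; apply: eq_bigr => l _; rewrite mulrBr mulrDr.
  (* Exchanging k and l in the third sum matches it with the first, by symmetry of g and of its
     inverse. *)
  rewrite addrAC [X in _ - X]exchange_big /=.
  rewrite -sumrB big1 ?add0r => [|k _].
    apply: eq_bigr => k _; apply: eq_bigr => l _; congr (_ * _).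
    by apply: pd_eq_dom => // y; apply: gC.
  rewrite -sumrB big1// => l _.
  rewrite hC (pd_eq_dom _ _ _ (fun y => g c y l j) _ _ xc) ?subrr// => y.
  exact: gC.
rewrite /divergence /nabla.
under eq_bigr do rewrite mxE along_frame.
rewrite big_split /=; congr (_ + _); first by apply: eq_bigr => k _; rewrite mxE.
(* The field [frame k] selects i = k, leaving Γ^k_kj X^j. *)
transitivity (\sum_k \sum_j christoffel g c k k j x * X c x 0 j).
  apply: eq_bigr => k _; rewrite (bigD1 k)//= [X in _ + X]big1 ?addr0 => [|i ik].
    by apply: eq_bigr => j _; rewrite mxE !eqxx mulr1.
  by rewrite big1// => j _; rewrite mxE (negPf ik) andbF mulr0 mul0r.
rewrite exchange_big /=; under eq_bigr do rewrite -mulr_suml contraction -mulrA.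
rewrite -mulr_sumr; congr (_ * _).
under eq_bigr do rewrite mulr_suml.
rewrite exchange_big; apply: eq_bigr => k _ /=.
under eq_bigr do rewrite mulr_suml.
rewrite exchange_big mxE; apply: eq_bigr => l _ /=.
rewrite mxE mulr_sumr; apply: eq_bigr => j _.
by rewrite mulrAC mulrA.
Qed.

(** By cyclicity and invariance under transposition, each of the two terms of [lie_metricE] in ∂X
    contributes ∂_k X^k; the total is twice [divergenceE]. *)
Lemma trace_lie_metric (X : vector_components M) c x : dom c x ->
  \tr (invmx (g c x) *m lie_metric g X c x) = 2 * divergence g X c x.
Proof.
move=> xc; have gU := metric_unit _ _ xc.
rewrite divergenceE// lie_metricE !mulmxDr !mxtraceD mulrDr mulVKf ?pnatr_eq0//.
rewrite mulKmx// mxtrace_tr (mxtrace_mulC _ (_ *m g c x)) mulmxK//; ring.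
Qed.

(** The divergence differentiates components, so agreement on all of [dom c] is used, not just at x.
    This lets [xi] replace the gradient of f. *)
Lemma divergence_eq_dom (X Y : vector_components M) c x :
    (forall y, dom c y -> X c y = Y c y) -> dom c x ->
  divergence g X c x = divergence g Y c x.
Proof.
move=> XY xc; apply: eq_bigr => k _; rewrite !mxE XY//; congr (_ + _).
by apply: along_eq_dom => // y yc; rewrite XY.
Qed.

(** Lowering an index is an isometry from g to the inverse metric on 1-forms. *)
Lemma dual_form_norm (X : vector_components M) c x : dom c x ->
  dual_form g X c x *m invmx (g c x) *m (dual_form g X c x)^T =
    X c x *m g c x *m (X c x)^T.
Proof.
move=> xc; rewrite /dual_form trmx_mul (Defs.metric_sym g_metric)// mulmxK ?metric_unit//.
by rewrite mulmxA.
Qed.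

End ChartCalculus.

(** * The Poisson equation *)

Theorem theorem4p4 (R : realType) (M : manifold R 4)
    (g : form_components M) (xi : vector_components M)
    (p sigma f : M -> R) (lambda k a b : R)
    (fluid : is_perfect_fluid g xi p sigma lambda k)
    (f_smooth : smooth (charts M) f)
    (xi_grad : forall (c : chart (charts M)) (x : M), dom c x ->
       xi c x = gradient g f c x)
    (soliton : is_eta_einstein_soliton g xi a b) :
  forall (c : chart (charts M)) (x : M), dom c x ->
    laplacian g f c x = - 3 * (b + k * (sigma x + p x)).
Proof.
move=> c x xc; have gL := fluid_metric fluid.
have -> : laplacian g f c x = divergence g xi c x.
  by symmetry; apply: divergence_eq_dom => // y; apply: xi_grad.
set S := ricci g c x; set r := scalar_curvature g c x.
set u := xi c x; set v := dual_form g xi c x.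
have gU := metric_unit gL c x xc.
have unit : (u *m g c x *m u^T) 0 0 = -1 by exact: (fluid_unit fluid xc).
have tr_g : \tr (invmx (g c x) *m g c x) = 4 by rewrite mulVmx// mxtrace1.
(* Cyclicity of the trace turns this into the squared norm of η under the inverse metric, which is
   g(ξ, ξ). *)
have tr_v : \tr (invmx (g c x) *m tensor_square v) = -1.
  by rewrite trace_tensor_square dual_form_norm.
have self_v : (u *m tensor_square v *m u^T) 0 0 = 1.
  (* Here η(ξ) = g(ξ, ξ) = -1, so (η ⊗ η)(ξ, ξ) = (-1)^2. *)
  have vu : v *m u^T = (-1)%:M by rewrite [LHS]mx11_scalar unit.
  rewrite /tensor_square mulmxA -mulmxA vu mul_mx_scalar -[u *m _]trmxK.
  by rewrite trmx_mul trmxK vu tr_scalar_mx !mxE eqxx mulrNN mulr1.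
have self_lie : (u *m lie_metric g xi c x *m u^T) 0 0 = 0.
  rewrite (lie_metric_self gL)//; last exact: (fluid_velocity fluid).
  rewrite (along_eq_dom _ _ _ (fun=> -1))// ?along_cst// => y.
  exact: (fluid_unit fluid).
have ein := fluid_einstein fluid xc; have sol := soliton c x xc.
(* The evaluations on (ξ, ξ) are also written as traces, of 1 by 1 matrices, so that linearity of
   the trace expands all four contractions at once. *)
move: (congr1 (fun B => \tr (invmx (g c x) *m B)) ein).
move: (congr1 (fun B => \tr (u *m B *m u^T)) ein).
move: (congr1 (fun B => \tr (invmx (g c x) *m B)) sol).
move: (congr1 (fun B => \tr (u *m B *m u^T)) sol).
rewrite /stress_energy -/v -/S -/r.
rewrite !(mulmx0, mul0mx, mulmxDr, mulmxDl, =^~ scalemxAr, =^~ scalemxAl).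
rewrite !(mxtraceD, mxtraceZ, mxtrace0) tr_g tr_v (trace_lie_metric gL)//.
rewrite -/(scalar_curvature g c x) -/r !trace_mx11 self_lie self_v unit.
(* With s = S(ξ, ξ), the equations read div ξ = r - 4a + b, 2a = 2s + r + 2b, s = λ - r/2 + kσ and r
   = 4λ + k(σ - 3p). They are linear once kp and kσ count as atoms, and eliminating a, s and r also
   cancels λ. *)
lra.
Qed.
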